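(* Let $S$ be a totally umbilical PAInv-submanifold of a Kenmotsu space form $\bar M(c)$. Then either $S$ is a totally geodesic totally real submanifold (totally real meaning $\phi(T_pS)\subseteq T_p^\perp S$ for all $p\in S$), or $c=-1$.
   Context: An almost contact metric manifold $(\bar M,\phi,\xi,\eta,g)$ is a Riemannian manifold $(\bar M,g)$ of dimension $2n+1$ with a $(1,1)$-tensor field $\phi$, a vector field $\xi$ and a 1-form $\eta$ such that $\phi^2=-I+\eta\otimes\xi$, $\eta(\xi)=1$, $\phi\xi=0$, $\eta\circ\phi=0$ and $g(\phi X,\phi Y)=g(X,Y)-\eta(X)\eta(Y)$. It is a Kenmotsu manifold if its Levi-Civita connection $\bar\nabla$ satisfies $(\bar\nabla_X\phi)Y=g(\phi X,Y)\xi-\eta(Y)\phi X$ (hence $\bar\nabla_X\xi=X-\eta(X)\xi$). A Kenmotsu space form $\bar M(c)$ is a Kenmotsu manifold of constant $\phi$-sectional curvature $c$; its curvature tensor is $\tilde R(X,Y)Z=\frac{c-3}{4}\{g(Y,Z)X-g(X,Z)Y\}+\frac{c+1}{4}[\eta(X)\eta(Z)Y-\eta(Y)\eta(Z)X+g(X,Z)\eta(Y)\xi-g(Y,Z)\eta(X)\xi+g(\phi Y,Z)\phi X-g(\phi X,Z)\phi Y-2g(\phi X,Y)\phi Z]$. Let $S$ be an immersed submanifold of $\bar M$ with $\xi$ tangent to $S$. For $X$ tangent to $S$ write $\phi X=TX+NX$ with $TX$ tangent and $NX$ normal to $S$. $S$ is a PAInv-submanifold (partially anti-invariant submanifold) if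 there are mutually orthogonal distributions $\mathfrak D$ (the ambiguous distribution) and $\mathfrak D^\perp$ on $S$ with orthogonal decomposition $TS=\mathfrak D\oplus\mathfrak D^\perp\oplus\langle\xi\rangle$, $\phi\mathfrak D^\perp\subseteq TS^\perp$ ($\mathfrak D^\perp$ is anti-invariant) and $T\mathfrak D\subseteq\mathfrak D$. With $h$ the second fundamental form of $S$ and $\mathcal H$ its mean curvature vector, $S$ is totally umbilical if $h(Z,W)=g(Z,W)\mathcal H$ for all $Z,W\in\Gamma(TS)$, and totally geodesic if $h=0$. *)

(* Defs.v *)
From HB Require Import structures.
From mathcomp Require Import all_boot all_order all_algebra.
From mathcomp Require Import boolp classical_sets functions reals.
From mathcomp Require Import topology normedtype derive.
Set Implicit Arguments.
Unset Strict Implicit.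
Unset Printing Implicit Defensive.
Import Order.TTheory GRing.Theory Num.Theory.
Import numFieldNormedType.Exports.
Local Open Scope classical_set_scope.
Local Open Scope ring_scope.

(* Only used for open [U]. *)
Fixpoint Ck (R : realType) (m k : nat) (U : set 'rV[R]_m)
    (f : 'rV[R]_m -> R) : Prop :=
  match k with
  | 0%N => forall x, U x -> {for x, continuous f}
  | k'.+1 => (forall x, U x -> differentiable f x) /\
             (forall v : 'rV[R]_m, Ck k' U (fun x => 'D_v f x))
  end.

Definition Cinf (R : realType) (m : nat) (U : set 'rV[R]_m)
    (f : 'rV[R]_m -> R) : Prop := forall k, Ck k U f.

(* The homeomorphism and its inverse are total functions; only their values
   on [cdom] and on [cmap @` cdom] are meaningful. *)
Record chart (R : realType) (m : nat) (M : topologicalType) := Chart {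
  cdom : set M;
  cmap : M -> 'rV[R]_m;
  cinv : 'rV[R]_m -> M;
  cdom_open : open cdom;
  ccod_open : open (cmap @` cdom);
  cmapK : forall p, cdom p -> cinv (cmap p) = p;
  cmap_continuous : forall p, cdom p -> {for p, continuous cmap};
  cinv_continuous : forall x, (cmap @` cdom) x -> {for x, continuous cinv}
}.

Record manifold (R : realType) (m : nat) := Manifold {
  carrier :> topologicalType;
  atlas : set (chart R m carrier);
  manifold_hausdorff : hausdorff_space carrier;
  manifold_second_countable : @second_countable carrier;
  atlas_cover : forall p : carrier, exists2 e, atlas e & cdom e p;
  atlas_compatible : forall e e', atlas e -> atlas e' -> forall j : 'I_m,
    Cinf (cmap e @` (cdom e `&` cdom e')) (fun x => cmap e' (cinv e x) 0 j)
}.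

(* A vector at a point is a derivation f |-> v f, encoded as an element of the
   real vector space (M -> R) -> R that vanishes off C^oo(M). *)
Notation vec R M := ((M -> R) -> R).
Notation vfield R M := (M -> vec R M).

Section Manifold.
Context {R : realType} {m : nat} {M : manifold R m}.

Definition smooth (f : M -> R) : Prop :=
  forall e, atlas e -> Cinf (cmap e @` cdom e) (f \o cinv e).

(* f |-> directional derivative at p along \sum_j a_j d/dx^j in the chart e. *)
Definition chart_vec (e : chart R m M) (a : 'rV[R]_m) (p : M) : vec R M :=
  fun f => if `[< smooth f >] then 'D_a (f \o cinv e) (cmap e p) else 0.

Definition tangent (p : M) : set (vec R M) :=
  [set v | exists e a, [/\ atlas e, cdom e p & v = chart_vec e a p]].

Definition is_vfield (X : vfield R M) : Prop :=
  (forall p, tangent p (X p)) /\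
  (forall f, smooth f -> smooth (fun p => X p f)).

Definition bracket (X Y : vfield R M) : vfield R M :=
  fun p f => X p (fun q => Y q f) - Y p (fun q => X q f).

(* A smooth subbundle of constant rank r of the tangent bundle. *)
Definition distribution (r : nat) (D : forall p : M, set (vec R M)) : Prop :=
  forall p : M, exists2 X : 'I_r -> vfield R M, (forall i, is_vfield (X i)) &
    \forall q \near p,
      D q = [set v | exists a : 'I_r -> R, v = \sum_i a i *: X i q] /\
      (forall a : 'I_r -> R, \sum_i a i *: X i q = 0 -> forall i, a i = 0).

End Manifold.

Section Riemann.
Context {R : realType} {m : nat} {M : manifold R m}.
Implicit Types (g : M -> vec R M -> vec R M -> R) (X Y Z : vfield R M).
Implicit Types (nabla : vfield R M -> vfield R M -> vfield R M).

(* The values of a tensor off the tangent spaces are irrelevant. *)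
Record riemannian_metric g : Prop := {
  metric_sym : forall p u v, tangent p u -> tangent p v -> g p u v = g p v u;
  metric_linear : forall p a u v w,
    tangent p u -> tangent p v -> tangent p w ->
    g p (a *: u + v) w = a * g p u w + g p v w;
  metric_pos : forall p u, tangent p u -> u != 0 -> 0 < g p u u;
  metric_smooth : forall X Y, is_vfield X -> is_vfield Y ->
    smooth (fun p => g p (X p) (Y p))
}.

Record levi_civita g nabla : Prop := {
  lc_vfield : forall X Y, is_vfield X -> is_vfield Y -> is_vfield (nabla X Y);
  lc_linear : forall f X Y Z, smooth f ->
    is_vfield X -> is_vfield Y -> is_vfield Z -> forall p,
    nabla (fun q => f q *: X q + Y q) Z p = f p *: nabla X Z p + nabla Y Z p;
  lc_leibniz : forall f X Y Z, smooth f ->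
    is_vfield X -> is_vfield Y -> is_vfield Z -> forall p,
    nabla X (fun q => f q *: Y q + Z q) p =
      f p *: nabla X Y p + X p f *: Y p + nabla X Z p;
  lc_torsion_free : forall X Y, is_vfield X -> is_vfield Y -> forall p,
    nabla X Y p - nabla Y X p = bracket X Y p;
  lc_metric : forall X Y Z, is_vfield X -> is_vfield Y -> is_vfield Z ->
    forall p, X p (fun q => g q (Y q) (Z q)) =
      g p (nabla X Y p) (Z p) + g p (Y p) (nabla X Z p)
}.

Definition curvature nabla X Y Z : vfield R M := fun p =>
  nabla X (nabla Y Z) p - nabla Y (nabla X Z) p - nabla (bracket X Y) Z p.

End Riemann.

Section Kenmotsu.
Context {R : realType} {m : nat} {M : manifold R m}.
Variables (phi : M -> vec R M -> vec R M) (xi : vfield R M).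
Variables (eta : M -> vec R M -> R) (g : M -> vec R M -> vec R M -> R).
Variable (nabla : vfield R M -> vfield R M -> vfield R M).

Definition apply_phi (X : vfield R M) : vfield R M := fun p => phi p (X p).

Record almost_contact_metric : Prop := {
  acm_metric : riemannian_metric g;
  phi_tangent : forall p u, tangent p u -> tangent p (phi p u);
  phi_linear : forall p a u v, tangent p u -> tangent p v ->
    phi p (a *: u + v) = a *: phi p u + phi p v;
  phi_smooth : forall X, is_vfield X -> is_vfield (apply_phi X);
  xi_vfield : is_vfield xi;
  eta_linear : forall p a u v, tangent p u -> tangent p v ->
    eta p (a *: u + v) = a * eta p u + eta p v;
  eta_smooth : forall X, is_vfield X -> smooth (fun p => eta p (X p));
  phi_phi : forall p u, tangent p u ->
    phi p (phi p u) = - u + eta p u *: xi p;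
  eta_xi : forall p, eta p (xi p) = 1;
  phi_xi : forall p, phi p (xi p) = 0;
  eta_phi : forall p u, tangent p u -> eta p (phi p u) = 0;
  g_phi : forall p u v, tangent p u -> tangent p v ->
    g p (phi p u) (phi p v) = g p u v - eta p u * eta p v
}.

Record kenmotsu : Prop := {
  kenmotsu_acm : almost_contact_metric;
  kenmotsu_lc : levi_civita g nabla;
  (* (nabla_X phi) Y = nabla_X (phi Y) - phi (nabla_X Y) *)
  kenmotsu_phi : forall X Y, is_vfield X -> is_vfield Y -> forall p,
    nabla X (apply_phi Y) p - phi p (nabla X Y p) =
      g p (phi p (X p)) (Y p) *: xi p - eta p (Y p) *: phi p (X p)
}.

(* The sectional curvature of the plane spanned by the orthonormal pair
   u, phi u, for u = X p a unit vector orthogonal to xi p, is c. *)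
Definition constant_phi_sectional_curvature (c : R) : Prop :=
  forall X, is_vfield X -> forall p,
    g p (X p) (X p) = 1 -> g p (X p) (xi p) = 0 ->
    g p (curvature nabla X (apply_phi X) (apply_phi X) p) (X p) = c.

Record kenmotsu_space_form (c : R) : Prop := {
  space_form_kenmotsu : kenmotsu;
  space_form_curvature : constant_phi_sectional_curvature c
}.

End Kenmotsu.

Section SmoothMap.
Context {R : realType} {k m : nat} {S : manifold R k} {M : manifold R m}.
Variable (iota : S -> M).

Definition smooth_map : Prop :=
  continuous iota /\
  forall e e', atlas e -> atlas e' -> forall j : 'I_m,
    Cinf (cmap e @` (cdom e `&` iota @^-1` cdom e'))
         (fun x => cmap e' (iota (cinv e x)) 0 j).

Definition differential (v : vec R S) : vec R M :=
  fun f => if `[< smooth f >] then v (f \o iota) else 0.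

Definition immersion : Prop :=
  smooth_map /\
  forall p u v, tangent p u -> tangent p v ->
    differential u = differential v -> u = v.

End SmoothMap.

Section Submanifold.
Context {R : realType} {k m : nat} {S : manifold R k} {M : manifold R m}.
Variables (iota : S -> M) (g : M -> vec R M -> vec R M -> R).
Variable (nabla : vfield R M -> vfield R M -> vfield R M).
Variables (phi : M -> vec R M -> vec R M) (xi : vfield R M).

Definition normal (p : S) : set (vec R M) :=
  [set w | tangent (iota p) w /\
     forall u, tangent p u -> g (iota p) w (differential iota u) = 0].

(* The unique u in T_p S such that w - d iota u is normal. *)
Definition tangential_part (p : S) (w : vec R M) : vec R S :=
  xget 0 [set u | tangent p u /\ normal p (w - differential iota u)].

Definition normal_part (p : S) (w : vec R M) : vec R M :=
  w - differential iota (tangential_part p w).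

Definition tangent_at (p : S) (X : vfield R M) : Prop :=
  exists2 u, tangent p u & differential iota u = X (iota p).

Definition tangent_to (X : vfield R M) : Prop := forall p, tangent_at p X.

(* The vector fields of M which extend a vector field of S near p. *)
Definition tangent_near (p : S) (X : vfield R M) : Prop :=
  is_vfield X /\ \forall q \near p, tangent_at q X.

(* As usual, a vector field on S is extended to the ambient manifold in order
   to be differentiated: h(X, Y)_p is the normal part of (nabla_X Y)_p, for X
   and Y as in [tangent_near p]. *)
Definition second_fundamental_form (X Y : vfield R M) (p : S) : vec R M :=
  normal_part p (nabla X Y (iota p)).
Local Notation h := second_fundamental_form.

(* (1/k) \sum_i h(E_i, E_i)_p, for any (E_i) orthonormal at p. *)
Definition mean_curvature (p : S) : vec R M :=
  xget 0 [set H | exists E : 'I_k -> vfield R M,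
    [/\ forall i, tangent_near p (E i),
        forall i j, g (iota p) (E i (iota p)) (E j (iota p)) = (i == j)%:R &
        H = k%:R^-1 *: \sum_i h (E i) (E i) p]].

Definition totally_umbilical : Prop :=
  forall p X Y, tangent_near p X -> tangent_near p Y ->
    h X Y p = g (iota p) (X (iota p)) (Y (iota p)) *: mean_curvature p.

Definition totally_geodesic : Prop :=
  forall p X Y, tangent_near p X -> tangent_near p Y -> h X Y p = 0.

Definition totally_real : Prop :=
  forall p u, tangent p u -> normal p (phi (iota p) (differential iota u)).

(* [D] is the ambiguous distribution, [D'] the anti-invariant one. *)
Record partially_anti_invariant_decomposition
    (D D' : forall p : S, set (vec R S)) : Prop := {
  painv_orth : forall p u v, D p u -> D' p v ->
    g (iota p) (differential iota u) (differential iota v) = 0;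
  painv_orth_xi : forall p u, D p u \/ D' p u ->
    g (iota p) (differential iota u) (xi (iota p)) = 0;
  painv_sum : forall p w, tangent p w -> exists u v t, [/\ D p u, D' p v &
    differential iota w =
      differential iota u + differential iota v + t *: xi (iota p)];
  painv_anti_invariant : forall p v, D' p v ->
    normal p (phi (iota p) (differential iota v));
  painv_ambiguous : forall p u, D p u ->
    D p (tangential_part p (phi (iota p) (differential iota u)))
}.

Definition partially_anti_invariant : Prop :=
  exists r r' D D', [/\ distribution r D, distribution r' D' &
    partially_anti_invariant_decomposition D D'].

End Submanifold.

(* Main.v *)
Require Import Defs.
From HB Require Import structures.
From mathcomp Require Import all_boot all_order all_algebra.
From mathcomp Require Import boolp classical_sets functions reals.
From mathcomp Require Import topology normedtype landau sequences derive.
From mathcomp Require Import realfun exp.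
From mathcomp Require Import ring lra.
Set Implicit Arguments.
Unset Strict Implicit.
Unset Printing Implicit Defensive.
Import Order.TTheory GRing.Theory Num.Theory.
Import numFieldNormedType.Exports.
Local Open Scope classical_set_scope.
Local Open Scope ring_scope.

(** Two independent facts give the theorem.

    Umbilicity with [xi] tangent kills the mean curvature: in a Kenmotsu
    manifold [nabla_X xi = X - eta(X) xi], so [nabla_xi xi = 0], hence
    [h(xi, xi) = 0], while umbilicity says [h(xi, xi) = g(xi, xi) H = H].
    Thus [H = 0] and [h = g H = 0] ([totally_umbilical_geodesic]).

    The value [c = -1] is forced by the ambient manifold as soon as it has a
    tangent vector which is not a multiple of [xi].  Geometrically, a Kenmotsu
    manifold is locally a warped product [dt^2 + e^(2t) g_F], whose horizontal
    sectional curvatures are [K_F e^(-2t) - 1]; such a function is constant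
    along [xi = d/dt] only if it equals [-1].  Infinitesimally, the second
    Bianchi identity and the formula [R(Y, xi) Z = g(Y, Z) xi - eta(Z) Y] give
    the derivative of [F(X) = g(R(X, phi X) phi X, X)] along [xi] for a
    horizontal field [X] ([deriv_phi_curvature]): up to the derivative of the
    quartic form [F] in the direction [nabla_xi X], it is
    [-2 (F(X) + |X|^4)].  Since [F(X) = c |X|^4] for all horizontal [X],
    polarizing [F] makes the direction terms cancel, and
    [(1 + c) |X|^4 = 0] remains ([constant_phi_curvature]).

    So if [c <> -1], every tangent vector of the ambient manifold is a multiple
    of [xi] ([tangent_spanned_by_xi]), [phi] vanishes on tangent vectors, and
    the submanifold is totally real.

    The curvature computation never evaluates a tensor at a point: it is an
    identity between global vector fields and smooth functions, and it is
    carried out over an arbitrary module of derivations that has a metric and a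
    Levi-Civita connection.  What ties it to tangent vectors is that every
    tangent vector is the value of a global vector field ([vector_extension]),
    which rests on smooth bump functions, and hence on the flat function
    [exp(-1/t)] and on a calculus of [C^k] functions closed under
    composition. *)

(** * Curvature identities over a module of derivations *)

Section LeviCivitaAlgebra.
Variables (A : comPzRingType) (V : lmodType A).
Variables (D : V -> A -> A) (g : V -> V -> A) (N : V -> V -> V).

Definition commutator X Y := N X Y - N Y X.
Definition riemann X Y Z := N X (N Y Z) - N Y (N X Z) - N (commutator X Y) Z.
Local Notation B := commutator.
Local Notation Rm := riemann.

(** The smooth functions [A] and the vector fields [V] of a Riemannian manifold
    are only used through these laws.  Faithfulness of the action [D] replaces
    the bracket as data: it makes the commutator of a torsion-free connection
    satisfy the Jacobi identity.  [lca_char0] replaces division by integers. *)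
Record levi_civita_algebra : Prop := {
  lca_sym : forall X Y, g X Y = g Y X;
  lca_linear : forall a X Y Z, g (a *: X + Y) Z = a * g X Z + g Y Z;
  lca_definite : forall X, g X X = 0 -> X = 0;
  lca_deriv_additive : forall X a b, D X (a + b) = D X a + D X b;
  lca_deriv_leibniz : forall X a b, D X (a * b) = D X a * b + a * D X b;
  lca_deriv_linear : forall a X Y b, D (a *: X + Y) b = a * D X b + D Y b;
  lca_deriv_faithful : forall X, (forall a, D X a = 0) -> X = 0;
  lca_nabla_linear : forall a X Y Z, N (a *: X + Y) Z = a *: N X Z + N Y Z;
  lca_nabla_leibniz : forall a X Y Z,
    N X (a *: Y + Z) = a *: N X Y + D X a *: Y + N X Z;
  lca_torsion_free : forall X Y a, D (B X Y) a = D X (D Y a) - D Y (D X a);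
  lca_metric : forall X Y Z, D X (g Y Z) = g (N X Y) Z + g Y (N X Z);
  lca_char0 : forall n (a : A), a *+ n.+1 = 0 -> a = 0
}.

Hypothesis H : levi_civita_algebra.

Let sym := lca_sym H.
Let g0 Z : g 0 Z = 0.
Proof.
have := lca_linear H 1 0 0 Z; rewrite scaler0 addr0 mul1r.
by move=> /esym/(canRL (addrK _)); rewrite subrr.
Qed.
Let gZl a X Y : g (a *: X) Y = a * g X Y.
Proof. by have := lca_linear H a X 0 Y; rewrite !addr0 g0 addr0. Qed.
Let gDl X Y Z : g (X + Y) Z = g X Z + g Y Z.
Proof. by have := lca_linear H 1 X Y Z; rewrite scale1r mul1r. Qed.
Let gNl X Z : g (- X) Z = - g X Z.
Proof. by rewrite -scaleN1r gZl mulN1r. Qed.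
Let gZr a X Y : g X (a *: Y) = a * g X Y. Proof. by rewrite sym gZl sym. Qed.
Let gDr X Y Z : g Z (X + Y) = g Z X + g Z Y.
Proof. by rewrite sym gDl !(sym _ Z). Qed.
Let gNr X Z : g Z (- X) = - g Z X. Proof. by rewrite sym gNl sym. Qed.
Let gE := (gDl, gDr, gNl, gNr, gZl, gZr).

Let g_inj X Y : (forall Z, g X Z = g Y Z) -> X = Y.
Proof.
move=> XY; apply/subr0_eq/(lca_definite H).
by rewrite gDl gNl XY subrr.
Qed.

Let D0 X : D X 0 = 0.
Proof.
have /esym/(canRL (addrK _)) := lca_deriv_additive H X 0 0.
by rewrite addr0 subrr.
Qed.
Let DN X a : D X (- a) = - D X a.
Proof.
by apply/eqP; rewrite -addr_eq0 addrC -lca_deriv_additive// subrr D0.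
Qed.
Let DM := lca_deriv_leibniz H.
Let D1 X : D X 1 = 0.
Proof.
by have /esym/(canRL (addrK _)) := DM X 1 1; rewrite !mulr1 mul1r subrr.
Qed.
Let DvD X Y a : D (X + Y) a = D X a + D Y a.
Proof. by have := lca_deriv_linear H 1 X Y a; rewrite scale1r mul1r. Qed.

Let ND X Y Z : N (X + Y) Z = N X Z + N Y Z.
Proof. by have := lca_nabla_linear H 1 X Y Z; rewrite !scale1r. Qed.
Let N0 Z : N 0 Z = 0.
Proof. by have /esym/(canRL (addrK _)) := ND 0 0 Z; rewrite addr0 subrr. Qed.
Let NZ a X Z : N (a *: X) Z = a *: N X Z.
Proof. by have := lca_nabla_linear H a X 0 Z; rewrite N0 !addr0. Qed.
Let NN X Z : N (- X) Z = - N X Z.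
Proof. by rewrite -scaleN1r NZ scaleN1r. Qed.
Let nD X Y Z : N X (Y + Z) = N X Y + N X Z.
Proof.
by have := lca_nabla_leibniz H 1 X Y Z; rewrite !scale1r D1 scale0r addr0.
Qed.
Let n0 X : N X 0 = 0.
Proof. by have /esym/(canRL (addrK _)) := nD X 0 0; rewrite addr0 subrr. Qed.
Let nZ X a Y : N X (a *: Y) = a *: N X Y + D X a *: Y.
Proof. by have := lca_nabla_leibniz H a X Y 0; rewrite n0 !addr0. Qed.
Let nN X Y : N X (- Y) = - N X Y.
Proof. by apply/eqP; rewrite -addr_eq0 addrC -nD subrr n0. Qed.
Let nE := (ND, nD, NN, nN).
Let metric := lca_metric H.

Let BDl X Y Z : B (X + Y) Z = B X Z + B Y Z.
Proof. by rewrite /B ND nD opprD addrACA. Qed.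
Let BC X Y : B X Y = - B Y X.
Proof. by rewrite /B opprB. Qed.
Let BNl X Y : B (- X) Y = - B X Y.
Proof. by rewrite /B NN nN opprB opprK addrC. Qed.

Lemma jacobi X Y Z : B X (B Y Z) + B Y (B Z X) + B Z (B X Y) = 0.
Proof.
apply: (lca_deriv_faithful H) => a; rewrite (DvD (B _ _ + B _ _)).
rewrite (DvD (B _ _)) !(lca_torsion_free H).
by rewrite !(lca_deriv_additive H) !DN; ring.
Qed.

Lemma riemann_Dl X Y Z W : Rm (X + Y) Z W = Rm X Z W + Rm Y Z W.
Proof. by apply: g_inj => U; rewrite /Rm BDl !(nE, gE); ring. Qed.
Lemma riemann_Nl X Y Z : Rm (- X) Y Z = - Rm X Y Z.
Proof. by apply: g_inj => U; rewrite /Rm BNl !(nE, gE); ring. Qed.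
Lemma riemannC X Y Z : Rm X Y Z = - Rm Y X Z.
Proof. by apply: g_inj => U; rewrite /Rm (BC Y) !(nE, gE); ring. Qed.
Lemma riemann_Dm X Y Z W : Rm X (Y + Z) W = Rm X Y W + Rm X Z W.
Proof. by rewrite riemannC riemann_Dl opprD -!riemannC. Qed.
Lemma riemann_Nm X Y Z : Rm X (- Y) Z = - Rm X Y Z.
Proof. by rewrite riemannC riemann_Nl -riemannC. Qed.
Lemma riemann_Dr X Y Z W : Rm X Y (Z + W) = Rm X Y Z + Rm X Y W.
Proof. by apply: g_inj => U; rewrite /Rm !(nE, gE); ring. Qed.
Lemma riemann_Nr X Y Z : Rm X Y (- Z) = - Rm X Y Z.
Proof. by apply: g_inj => U; rewrite /Rm !(nE, gE); ring. Qed.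
Let RE := (riemann_Dl, riemann_Nl, riemann_Dm, riemann_Nm,
  riemann_Dr, riemann_Nr).

(** For a torsion-free connection this is the Jacobi identity. *)
Lemma first_bianchi X Y Z : Rm X Y Z + Rm Y Z X + Rm Z X Y = 0.
Proof.
rewrite -(jacobi X Y Z); apply: g_inj => U.
by rewrite /Rm /B !(nE, gE); ring.
Qed.

Lemma mulrnI_char0 n (a b : A) : a *+ n.+1 = b *+ n.+1 -> a = b.
Proof.
move=> ab; apply/subr0_eq/(lca_char0 H (n := n)).
by rewrite mulrnBl ab subrr.
Qed.

(** The commutator [D X D Y - D Y D X - D (B X Y)] vanishes on functions;
    applied to [g Z W], the metric property turns it into this identity. *)
Lemma riemann_skew X Y Z W : g (Rm X Y Z) W = - g (Rm X Y W) Z.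
Proof.
have e : D X (D Y (g Z W)) - D Y (D X (g Z W)) - D (B X Y) (g Z W) = 0.
  by rewrite (lca_torsion_free H) subrr.
move: e; rewrite !(metric, lca_deriv_additive H) => e.
apply/eqP; rewrite -addr_eq0 -e /Rm !gE; apply/eqP.
rewrite (sym (N X (N Y W))) (sym (N Y (N X W))) (sym (N (B X Y) W)).
by ring.
Qed.

(** The octahedron argument: adding four instances of the first Bianchi
    identity, all terms but twice the two sides cancel by skew-symmetry. *)
Lemma riemann_pair X Y Z W : g (Rm X Y Z) W = g (Rm Z W X) Y.
Proof.
have b P Q S T : g (Rm P Q S) T + g (Rm Q S P) T + g (Rm S P Q) T = 0.
  by rewrite -!gDl first_bianchi -(scale0r 0) gZl mul0r.
have s := riemann_skew.
have c P Q S T : g (Rm P Q S) T = - g (Rm Q P S) T by rewrite riemannC gNl.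
apply: (@mulrnI_char0 1); apply/subr0_eq.
rewrite -(addr0 0) -{1}(b Y Z X W) -(addr0 0) -{1}(b Z X W Y).
rewrite -(addr0 0) -{1}(b X W Y Z) -(b W Y Z X).
rewrite (s Z X W Y) (s X W Z Y) (c W Z) (s W Y X Z) (c Y X W Z) (s X Y W Z).
rewrite (s Y Z W X) (s Z W Y X).
ring.
Qed.

(** The Jacobi identity for the three operators [N P], [N X], [N Y], together
    with that of the commutator.  Keeping the terms [Rm (B _ _) _ _] makes
    it hold without any tensoriality. *)
Lemma second_bianchi P X Y Z :
  (N P (Rm X Y Z) - Rm X Y (N P Z)) + (N X (Rm Y P Z) - Rm Y P (N X Z)) +
    (N Y (Rm P X Z) - Rm P X (N Y Z)) =
  Rm (B X Y) P Z + Rm (B Y P) X Z + Rm (B P X) Y Z.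
Proof.
have J : N (B (B X Y) P) Z + N (B (B Y P) X) Z + N (B (B P X) Y) Z = 0.
  rewrite -!ND (BC (B X Y)) (BC (B Y P)) (BC (B P X)) -!opprD.
  by rewrite jacobi oppr0 N0.
apply: g_inj => U; have JU : g _ U = g _ U := congr1 (g^~ U) J.
rewrite /Rm; move: JU; rewrite -(scale0r 0) gZl mul0r.
move: (B (B X Y) P) (B (B Y P) X) (B (B P X) Y) => B1 B2 B3.
move: (B X Y) (B Y P) (B P X) => B4 B5 B6.
by rewrite !(nE, gE) => JU; rewrite -[LHS]subr0 -JU; ring.
Qed.

Variables (phi : V -> V) (xi : V).
Local Notation eta X := (g X xi).

(** The contact form is encoded as [g _ xi]. *)
Record kenmotsu_algebra : Prop := {
  ka_phi_linear : forall a X Y, phi (a *: X + Y) = a *: phi X + phi Y;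
  ka_xi_unit : g xi xi = 1;
  ka_phi_xi : phi xi = 0;
  ka_phi_phi : forall X, phi (phi X) = - X + eta X *: xi;
  ka_g_phi : forall X Y, g (phi X) (phi Y) = g X Y - eta X * eta Y;
  ka_nabla_phi : forall X Y,
    N X (phi Y) - phi (N X Y) = g (phi X) Y *: xi - eta Y *: phi X
}.

Hypothesis K : kenmotsu_algebra.

Let phiD X Y : phi (X + Y) = phi X + phi Y.
Proof. by have := ka_phi_linear K 1 X Y; rewrite !scale1r. Qed.
Let phi0 : phi 0 = 0.
Proof. by have /esym/(canRL (addrK _)) := phiD 0 0; rewrite addr0 subrr. Qed.
Let phiN X : phi (- X) = - phi X.
Proof. by apply/eqP; rewrite -addr_eq0 addrC -phiD subrr phi0. Qed.

Let etaphi X : eta (phi X) = 0.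
Proof.
have := ka_phi_phi K (phi X); rewrite (ka_phi_phi K X) phiD phiN.
have -> : phi (eta X *: xi) = 0.
  have := ka_phi_linear K (eta X) xi 0.
  by rewrite ka_phi_xi// phi0 !addr0 scaler0.
rewrite addr0 -[LHS]addr0 => /addrI/(congr1 (g^~ xi)).
by rewrite gZl ka_xi_unit// mulr1 => <-; rewrite -(scale0r 0) gZl mul0r.
Qed.

Let phi_skew X Y : g (phi X) Y = - g X (phi Y).
Proof.
have := ka_g_phi K (phi X) Y; rewrite etaphi mul0r subr0 => <-.
by rewrite ka_phi_phi// gDl gNl gZl (sym xi) etaphi mulr0 addr0.
Qed.

(** The derivative of [phi] along [X], applied to [xi], gives
    [phi (N X xi) = phi X]; applying [phi] again determines [N X xi] up to its
    component along [xi], which vanishes because [xi] has constant length. *)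
Lemma nabla_xi X : N X xi = X - eta X *: xi.
Proof.
have e : eta (N X xi) = 0.
  have := metric X xi xi; rewrite ka_xi_unit// D1 (sym xi) => /esym e.
  exact: (lca_char0 H (n := 1)).
have := ka_nabla_phi K X xi.
rewrite ka_phi_xi// n0 etaphi scale0r ka_xi_unit// scale1r !sub0r.
move/oppr_inj/(congr1 phi); rewrite !ka_phi_phi// e scale0r addr0.
by move/(canRL (@opprK _)) => ->; rewrite opprD opprK.
Qed.

Lemma eta_nabla X Z : eta (N X Z) = D X (eta Z) - g X Z + eta X * eta Z.
Proof. by rewrite metric nabla_xi !gE (sym Z X); ring. Qed.

Lemma eta_horizontal_part X : eta (X - eta X *: xi) = 0.
Proof. by rewrite !gE ka_xi_unit// mulr1 subrr. Qed.

Lemma riemann_xi X Y : Rm X Y xi = eta X *: Y - eta Y *: X.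
Proof.
apply: g_inj => U; rewrite /Rm !nabla_xi !(nE, nZ, gE) !nabla_xi /B !gE.
rewrite !eta_nabla (sym Y X); ring.
Qed.

(** By pair symmetry, from [riemann_xi]. *)
Lemma riemann_along_xi Y Z : Rm Y xi Z = g Y Z *: xi - eta Z *: Y.
Proof.
apply: g_inj => W; rewrite riemann_pair riemann_skew riemann_xi.
by rewrite !gE (sym xi W) (sym Z Y) (sym W Y); ring.
Qed.

Definition phi_curvature X := g (Rm X (phi X) (phi X)) X.

(* The quadri-additive form whose diagonal is [phi_curvature]. *)
Let F a b c d := g (Rm a (phi b) (phi c)) d.
Let FD1 a a' b c d : F (a + a') b c d = F a b c d + F a' b c d.
Proof. by rewrite /F riemann_Dl gDl. Qed.
Let FN1 a b c d : F (- a) b c d = - F a b c d.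
Proof. by rewrite /F riemann_Nl gNl. Qed.
Let FD2 a b b' c d : F a (b + b') c d = F a b c d + F a b' c d.
Proof. by rewrite /F phiD riemann_Dm gDl. Qed.
Let FN2 a b c d : F a (- b) c d = - F a b c d.
Proof. by rewrite /F phiN riemann_Nm gNl. Qed.
Let FD3 a b c c' d : F a b (c + c') d = F a b c d + F a b c' d.
Proof. by rewrite /F phiD riemann_Dr gDl. Qed.
Let FN3 a b c d : F a b (- c) d = - F a b c d.
Proof. by rewrite /F phiN riemann_Nr gNl. Qed.
Let FD4 a b c d d' : F a b c (d + d') = F a b c d + F a b c d'.
Proof. by rewrite /F gDr. Qed.
Let FN4 a b c d : F a b c (- d) = - F a b c d.
Proof. by rewrite /F gNr. Qed.
Let FL := (FD1, FN1, FD2, FN2, FD3, FN3, FD4, FN4).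

(** A factor [a] killed by all derivations behaves like a real constant; this
    homogeneity extends a hypothesis on unit vectors to all vectors. *)
Lemma phi_curvatureZ a X : (forall Y, D Y a = 0) ->
  phi_curvature (a *: X) = a ^+ 4 * phi_curvature X.
Proof.
move=> Da; have Na Y Z : N Y (a *: Z) = a *: N Y Z.
  by rewrite nZ Da scale0r addr0.
have R1 Y Z U : Rm (a *: Y) Z U = a *: Rm Y Z U.
  have BZ : B (a *: Y) Z = a *: B Y Z by rewrite /B NZ Na -scalerBr.
  by rewrite /Rm BZ !NZ !Na -!scalerBr.
have R3 Y Z U : Rm Y Z (a *: U) = a *: Rm Y Z U.
  by rewrite /Rm !Na -!scalerBr.
have R2 Y Z U : Rm Y (a *: Z) U = a *: Rm Y Z U.
  by rewrite riemannC R1 -scalerN -riemannC.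
have pa : phi (a *: X) = a *: phi X.
  by have := ka_phi_linear K a X 0; rewrite phi0 !addr0.
by rewrite /phi_curvature pa R1 R2 R3 gZr !gZl; ring.
Qed.

(** The second Bianchi identity for [xi], [X], [phi X], applied to [phi X] and
    paired with [X].  The brackets [B (phi X) xi = phi X - phi W] and
    [B xi X = W - X] produce the term [-2 F(X)], the derivatives of
    [R(_, xi) phi X] produce [-2 |X|^4]. *)
Lemma deriv_phi_curvature X : eta X = 0 ->
  let W := N xi X in
  D xi (phi_curvature X) = - (g X X ^+ 2 + phi_curvature X) *+ 2 +
    (F W X X X + F X W X X + F X X W X + F X X X W).
Proof.
move=> X0 W; set Y := phi X.
have Y0 : eta Y = 0 by exact: etaphi.
have YX : g Y X = 0.
  apply: (lca_char0 H (n := 1)).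
  by have := phi_skew X X; rewrite -/Y (sym X) mulr2n => {1}->; rewrite addNr.
have YY : g Y Y = g X X by rewrite ka_g_phi// X0 mul0r subr0.
have YW : N xi Y = phi W.
  apply/subr0_eq; rewrite ka_nabla_phi// ka_phi_xi// scaler0 subr0.
  by rewrite g0 scale0r.
have BYxi : B Y xi = Y - phi W by rewrite /B nabla_xi Y0 scale0r subr0 YW.
have BxiX : B xi X = W - X by rewrite /B nabla_xi X0 scale0r subr0.
have := congr1 (g^~ X) (second_bianchi xi X Y Y).
rewrite /= BYxi BxiX !(riemannC xi) !riemann_along_xi !RE Y0 !scale0r !subr0.
rewrite !eta_nabla X0 Y0 D0 (D0 Y) (sym X Y) YX scale0r !oppr0 n0 YW nZ.
rewrite nabla_xi X0 scale0r subr0 (riemannC Y X) (riemannC (phi W) X).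
rewrite /F /phi_curvature -/Y (metric xi) -/W.
(* Generalizing the curvature terms keeps [gE] from unfolding them as sums. *)
move: (Rm X Y Y) (Rm X Y (phi W)) (Rm X (phi W) Y) (Rm W Y Y) => R1 R2 R3 R4.
rewrite !gE g0 (sym xi X) X0 YX YY => e.
by apply/subr0_eq; move/eqP: e; rewrite -subr_eq0 => /eqP <-; ring.
Qed.

(** Kenmotsu: constant [phi]-sectional curvature [c] forces [c = -1] wherever
    there are horizontal vectors. *)
Theorem constant_phi_curvature (c : A) : (forall X, D X c = 0) ->
  (forall X, eta X = 0 -> phi_curvature X = c * g X X ^+ 2) ->
  forall X, eta X = 0 -> (1 + c) * g X X ^+ 2 = 0.
Proof.
move=> Dc cK X X0; have := deriv_phi_curvature X0; set W := N xi X => /= e.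
have W0 : eta W = 0.
  by rewrite eta_nabla X0 D0 (sym xi) X0 mulr0 subr0 addr0.
(* The coefficient of [t] in the quartic [f t = F (X + t W)] is recovered from
   four values: [12 f'(0) = 8 (f 1 - f (-1)) - (f 2 - f (-2))]. *)
have polar : F W X X X + F X W X X + F X X W X + F X X X W =
    c * g X X * g X W *+ 4.
  apply: (@mulrnI_char0 11).
  have cF Z : eta Z = 0 -> F Z Z Z Z = c * g Z Z ^+ 2 by move=> /cK.
  have p1 := cF (X + W); have p2 := cF (X - W).
  have p3 := cF (X + (W + W)); have p4 := cF (X - (W + W)).
  move: p1 p2 p3 p4; rewrite !(gDl, gNl) X0 W0 !(addr0, oppr0).
  move=> /(_ erefl) p1 /(_ erefl) p2 /(_ erefl) p3 /(_ erefl) p4.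
  clearbody W; move: p1 p2 p3 p4; rewrite !FL !gE (sym W X) => p1 p2 p3 p4.
  have q := congr2 (fun a b => a *+ 8 - b)
    (congr2 (fun a b => a - b) p1 p2) (congr2 (fun a b => a - b) p3 p4).
  apply/subr0_eq; move/eqP: q; rewrite -subr_eq0 => /eqP <-.
  ring.
move: e; rewrite polar (cK X X0) expr2 !DM Dc (metric xi) -/W (sym W X) => e.
apply: (lca_char0 H (n := 1)); apply/subr0_eq; rewrite subr0.
move/eqP: e; rewrite -subr_eq0 => /eqP <-; ring.
Qed.

End LeviCivitaAlgebra.

(** * Calculus of C^k functions on row vectors *)

Lemma open_near (T : topologicalType) (U : set T) x :
  open U -> U x -> \forall y \near x, U y.
Proof. by move=> oU Ux; apply: open_nbhs_nbhs. Qed.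

Lemma near_eq_differentiable (R : numFieldType) (V W : normedModType R)
    (f g : V -> W) (x : V) : {near x, f =1 g} ->
  differentiable f x -> differentiable g x.
Proof.
move=> fg /[dup] df /diff_locallyP[dfc dfx].
have gx : g \o shift x = cst (g x) + 'd f x +o_ 0 id.
  apply/eqaddoP => e e0; move/eqaddoP: dfx => /(_ e e0).
  have : \forall z \near 0, f (z + x) = g (z + x).
    have : \forall y \near x, f y = g y by [].
    by rewrite (near_shift 0 x)/= subr0.
  apply: filterS2 => z fgz; rewrite !fctE/= fgz.
  by rewrite (nbhs_singleton fg).
apply/diff_locallyP; have e := diff_unique dfc gx.
by rewrite e.
Qed.

Section Ck.
Variables (R : realType) (m : nat).
Implicit Types (U V : set 'rV[R]_m) (f h : 'rV[R]_m -> R).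

(** Membership in [C^k] is local, which is what allows gluing. *)
Lemma Ck_local k U f :
  (forall x, U x -> exists V, [/\ open V, V x & Ck k V f]) -> Ck k U f.
Proof.
elim: k U f => [|k IH] U f H /=.
  by move=> x /H[V [_ Vx]]; apply.
split=> [x /H[V [_ Vx []]] + _|v]; first exact.
by apply: IH => x /H[V [oV Vx [_ /(_ v)]]]; exists V.
Qed.

Lemma Ck_eq k U f h : open U -> (forall x, U x -> f x = h x) ->
  Ck k U f -> Ck k U h.
Proof.
move=> oU; elim: k f h => [|k IH] f h fh.
all: have nfh x : U x -> \forall y \near x, f y = h y
  by move=> /(open_near oU); apply: filterS => y; exact: fh.
  move=> H x Ux; suff : h y @[y --> x] --> h x by [].
  rewrite -(fh _ Ux); apply: cvg_trans (H x Ux).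
  apply: (@near_eq_cvg _ _ (nbhs x)).
  exact: nfh.
case=> df H; split=> [x Ux|v].
  by apply: near_eq_differentiable (df x Ux); exact: nfh.
apply: IH (H v) => x Ux; apply: near_eq_derive.
exact: nfh.
Qed.

Lemma CkS k U f : Ck k.+1 U f -> Ck k U f.
Proof.
elim: k f => [|k IH] f /= [df H].
  by move=> x /df /differentiable_continuous.
by split=> // v; apply: IH; exact: H.
Qed.

Lemma Ck_sub k U V f : U `<=` V -> Ck k V f -> Ck k U f.
Proof.
move=> UV; elim: k f => [|k IH] f /=; first by move=> H x /UV/H.
by case=> df H; split=> [x /UV/df//|v]; exact: IH.
Qed.

Lemma Ck_cst k U (a : R) : Ck k U (cst a).
Proof.
elim: k a => [|k IH] a /=; first by move=> x _; exact: (@cst_continuous).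
split=> [x _|v]; first exact: differentiable_cst.
have -> : (fun x => 'D_v (cst a) x) = cst 0 :> ('rV[R]_m -> R); last exact: IH.
by apply/funext => x; rewrite derive_cst.
Qed.

Lemma CkD k U f h : open U -> Ck k U f -> Ck k U h -> Ck k U (f \+ h).
Proof.
move=> oU; elim: k f h => [|k IH] f h /=.
  by move=> F H x Ux; apply: continuousD; [exact: (F x Ux)|exact: (H x Ux)].
move=> [df F] [dh H]; split=> [x Ux|v].
  by apply: differentiableD; [exact: df|exact: dh].
apply: (@Ck_eq _ _ ((fun x => 'D_v f x) \+ (fun x => 'D_v h x))) => //.
  by move=> x Ux; rewrite deriveD//; apply: diff_derivable; [exact: df|exact: dh].
exact: IH.
Qed.

Lemma CkM k U f h : open U -> Ck k U f -> Ck k U h -> Ck k U (f \* h).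
Proof.
move=> oU; elim: k f h => [|k IH] f h.
  by move=> F H x Ux; apply: continuousM; [exact: (F x Ux)|exact: (H x Ux)].
move=> Ff Fh; have [df F] := Ff; have [dh H] := Fh; split=> [x Ux|v].
  by apply: differentiableM; [exact: df|exact: dh].
apply: (@Ck_eq _ _
  ((f \* (fun x => 'D_v h x)) \+ (h \* (fun x => 'D_v f x)))) => //.
  move=> x Ux; rewrite deriveM//; apply: diff_derivable; [exact: df|exact: dh].
by apply: CkD => //; [exact: IH (CkS Ff) (H v)|exact: IH (CkS Fh) (F v)].
Qed.

Lemma Ck_sum k U n (F : 'I_n -> 'rV[R]_m -> R) : open U ->
  (forall i, Ck k U (F i)) -> Ck k U (fun x => \sum_i F i x).
Proof.
move=> oU HF; elim: n F HF => [|n IH] F HF.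
  by apply: (@Ck_eq _ _ (cst 0)) => // [x _|]; rewrite ?big_ord0//; exact: Ck_cst.
apply: (@Ck_eq _ _ ((fun x => \sum_(i < n) F (lift ord0 i) x) \+ F ord0)) => //.
  by move=> x _; rewrite big_ord_recl addrC.
by apply: CkD => //; exact: IH.
Qed.

Lemma Ck_coord k U (j : 'I_m) : Ck k U (fun x => x 0 j).
Proof.
case: k => [|k] /=; first by move=> x _; exact: coord_continuous.
split=> [x _|v]; first exact: differentiable_coord.
have -> : (fun x => 'D_v (fun y : 'rV[R]_m => y 0 j) x) = cst (v 0 j).
  apply/funext => x.
  have dx : derivable (@id 'rV[R]_m) x v by exact: derivable_id.
  by have := derive_mx dx; rewrite derive_id => /rowP/(_ j); rewrite mxE.
exact: Ck_cst.
Qed.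

End Ck.

Lemma differentiable_row (R : realType) (V : normedModType R) m
    (F : V -> 'rV[R]_m) x :
  (forall j, differentiable (fun y => F y 0 j) x) -> differentiable F x.
Proof.
move=> dF; have -> : F = \sum_(j < m) (fun y => F y 0 j *: 'e_j).
  by apply/funext => y; rewrite fct_sumE [LHS]row_sum_delta.
by apply: differentiable_sum => j; exact: differentiableZl.
Qed.

Lemma derive_chain (R : realType) (V : normedModType R) m
    (F : V -> 'rV[R]_m) (h : 'rV[R]_m -> R) x v :
  differentiable F x -> differentiable h (F x) ->
  'D_v (h \o F) x = \sum_j 'D_v (fun y => F y 0 j) x * 'D_('e_j) h (F x).
Proof.
move=> dF dh; rewrite deriveE; last exact: differentiable_comp.
rewrite diff_comp//= -(deriveE v dF) derive_mx; last exact: diff_derivable.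
rewrite [X in 'd h _ X]row_sum_delta linear_sum/=; apply: eq_bigr => j _.
by rewrite linearZ/= mxE (deriveE _ dh).
Qed.

(** By the chain rule the derivatives of [h \o F] are sums of products of
    derivatives of the coordinates of [F] and of functions of the same shape,
    with [h] replaced by its partial derivatives. *)
Lemma Ck_comp (R : realType) m m' (U : set 'rV[R]_m) (V : set 'rV[R]_m')
    (F : 'rV[R]_m -> 'rV[R]_m') (h : 'rV[R]_m' -> R) : open U ->
  (forall x, U x -> V (F x)) -> (forall j, Cinf U (fun x => F x 0 j)) ->
  Cinf V h -> Cinf U (h \o F).
Proof.
move=> oU UV HF Hh k; elim: k h Hh => [|k IH] h Hh.
  move=> x Ux; apply: continuous_comp; last exact: Hh 0%N _ (UV _ Ux).
  apply: differentiable_continuous; apply: differentiable_row => j.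
  by have [d _] := HF j 1%N; exact: d.
have dF x : U x -> differentiable F x.
  by move=> Ux; apply: differentiable_row => j; have [d _] := HF j 1%N; exact: d.
have dh x : U x -> differentiable h (F x).
  by move=> /UV ?; have [d _] := Hh 1%N; exact: d.
split=> [x Ux|v]; first by apply: differentiable_comp; [exact: dF|exact: dh].
apply: (@Ck_eq _ _ _ _ (fun x =>
  \sum_j 'D_v (fun y => F y 0 j) x * 'D_('e_j) h (F x))) => //.
  by move=> x Ux; rewrite derive_chain; [|exact: dF|exact: dh].
apply: Ck_sum => // j; apply: CkM => //.
  by have [_ H] := HF j k.+1; exact: H.
by apply: (IH (fun y => 'D_('e_j) h y)) => k'; have [_ H] := Hh k'.+1; exact: H.
Qed.

(** * Flat functions and bump functions *)

Section Flat.
Variable R : realType.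
Implicit Types t : R.

(** The powers of [1/t] make the family stable under differentiation, up to
    linear combinations. *)
Definition flat (n : nat) t : R :=
  if 0 < t then t^-1 ^+ n * expR (- t^-1) else 0.

Lemma flat_ge0 n t : 0 <= flat n t.
Proof.
rewrite /flat; case: ifP => // t0.
by rewrite mulr_ge0 ?expR_ge0// exprn_ge0// invr_ge0 ltW.
Qed.

(** Since [exp s >= s^(n+2) / (n+2)!], the function is [O(t^2)] at the origin,
    which makes its derivative vanish there. *)
Lemma flat_le n t : flat n t <= n.+2`!%:R * t ^+ 2.
Proof.
rewrite /flat; case: ifPn => [t0|_]; last by rewrite mulr_ge0 ?sqr_ge0.
have s0 : 0 < t^-1 by rewrite invr_gt0.
have -> : t ^+ 2 = (t^-1 ^+ 2)^-1 by rewrite exprVn invrK.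
move: (t^-1) s0 => s s0.
rewrite expRN ler_pdivlMr ?exprn_gt0// mulrAC -exprD addn2.
rewrite ler_pdivrMr ?expR_gt0// mulrC -ler_pdivrMr ?ltr0n ?fact_gt0//.
by apply: le_trans (expR_ge1Dxn n.+1 (ltW s0)); rewrite lerDr.
Qed.

Lemma is_derive_flat n t :
  is_derive t 1 (flat n) (flat n.+2 t - n%:R * flat n.+1 t).
Proof.
have [t0|t0|->] := ltgtP t 0.
- apply: (@near_eq_is_derive _ _ _ (cst 0)).
    near=> s; rewrite /flat ltNge ltW//; near: s; exact: lt_nbhsl.
  rewrite /flat ltNge ltW//= mulr0 subr0; exact: is_derive_cst.
- pose iv (s : R) := s^-1.
  have div : is_derive t 1 iv (- t ^- 2).
    apply: is_derive_eq; first by apply: is_deriveV; rewrite ?gt_eqF.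
    by rewrite /GRing.scale/= mulr1.
  apply: (@near_eq_is_derive _ _ _ (iv ^+ n * (expR \o - iv))).
    near=> s; rewrite /flat ifT; last by near: s; exact: lt_nbhsr.
    by rewrite !fctE.
  have dE := is_derive1_comp (is_derive_expR ((- iv) t)) (is_deriveN div).
  rewrite /flat t0; apply: is_derive_eq (is_deriveM (is_deriveX n div) dE) _.
  rewrite !fctE /GRing.scale/= /iv; case: n => [|n]/=.
    by rewrite expr0 !mul0r mulr0 addr0 subr0 mul1r opprK exprVn mulrC.
  rewrite opprK -exprVn !exprS; ring.
- rewrite {2 3}/flat ltxx mulr0 subr0.
  have H : (fun h => h^-1 *: (flat n (h *: 1 + 0) - flat n 0)) @ 0^' --> (0 : R).
    apply/cvgrPdist_le => e e0.
    have C0 : 0 < n.+2`!%:R :> R by rewrite ltr0n fact_gt0.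
    near=> h; have h0 : h != 0 by near: h; exact: nbhs_dnbhs_neq.
    rewrite {2}/flat ltxx subr0 sub0r normrN addr0 /GRing.scale/= mulr1.
    rewrite normrM normfV ler_pdivrMl ?normr_gt0// ger0_norm ?flat_ge0//.
    rewrite (le_trans (flat_le _ _))// -real_normK ?num_real// expr2 mulrCA.
    rewrite ler_wpM2l// -ler_pdivlMl// mulrC.
    near: h; apply: dnbhs0_le; exact: divr_gt0.
  apply: DeriveDef; first by apply/cvg_ex; exists 0.
  exact: cvg_lim.
Unshelve. all: by end_near. Qed.

End Flat.

Lemma Cinf_flat (R : realType) m (U : set 'rV[R]_m) u n : open U -> Cinf U u ->
  Cinf U (flat n \o u).
Proof.
move=> oU Cu k; elim: k n => [|k IH] n.
  move=> x Ux; apply: continuous_comp; first exact: Cu 0%N x Ux.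
  apply: differentiable_continuous; apply/derivable1_diffP.
  by have [] := is_derive_flat n (u x).
have df y : differentiable (@flat R n) y.
  by apply/derivable1_diffP; have [] := is_derive_flat n y.
have [du Du] := Cu 1%N.
split=> [x Ux|v]; first by apply: differentiable_comp; [exact: du|exact: df].
apply: (@Ck_eq _ _ _ _ (((flat n.+2 \o u) \+
  (cst (- n%:R) \* (flat n.+1 \o u))) \* (fun x => 'D_v u x))) => //.
  move=> x Ux; rewrite [RHS]deriveE; last first.
    by apply: differentiable_comp; [exact: du|exact: df].
  rewrite diff_comp//=; last exact: du.
  rewrite -(deriveE _ (du x Ux)) diff1E// derive1E.
  have [_ ->] := is_derive_flat n (u x).
  by rewrite /GRing.scale/= /cst; ring.
apply: CkM => //; last by have [_ H] := Cu k.+1; exact: H.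
by apply: CkD => //; apply: CkM => //; exact: Ck_cst.
Qed.

(** A single value [b a = 1] suffices to extend vectors, so the bump has no
    plateau. *)
Lemma bump_function (R : realType) m (V : set 'rV[R]_m) (a : 'rV[R]_m) :
  open V -> V a -> exists b : 'rV[R]_m -> R, exists K : set 'rV[R]_m,
    [/\ forall U, open U -> Cinf U b, b a = 1, compact K, K `<=` V &
        forall x, ~ K x -> b x = 0].
Proof.
move=> oV Va.
have /nbhs_ballP[r /= r0 rV] := open_near oV Va.
(* The norm of ['rV] is the sup norm, so the support of [flat 0 \o q] lies in the
   closed cube [K] of half-side [r / 2], inside the ball of radius [r]. *)
pose q (x : 'rV[R]_m) := (r / 2) ^+ 2 - \sum_j (x 0 j - a 0 j) ^+ 2.
have r2 : 0 < r / 2 by rewrite divr_gt0.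
have qa : q a = (r / 2) ^+ 2.
  by rewrite /q big1 ?subr0// => j _; rewrite subrr expr0n.
have fa : 0 < flat 0 (q a).
  by rewrite qa /flat exprn_gt0// mul1r expR_gt0.
exists (fun x => (flat 0 (q a))^-1 * flat 0 (q x)).
pose I j := `[a 0 j - r / 2, a 0 j + r / 2].
exists [set x : 'rV[R]_m | forall j, [set` I j] (x 0 j)].
have Cq U : open U -> Cinf U q.
  move=> oU k; pose d j : 'rV[R]_m -> R := (fun y => y 0 j) \+ cst (- a 0 j).
  apply: (@Ck_eq _ _ _ _ (cst ((r / 2) ^+ 2) \+
    (cst (-1) \* (fun x => \sum_j (d j \* d j) x)))) => //.
    by move=> x Ux; rewrite /q/= mulN1r; congr (_ - _).
  apply: CkD => //; first exact: Ck_cst.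
  apply: CkM => //; first exact: Ck_cst.
  apply: Ck_sum => // j; apply: CkM => //.
    by apply: CkD => //; [exact: Ck_coord|exact: Ck_cst].
  by apply: CkD => //; [exact: Ck_coord|exact: Ck_cst].
split.
- move=> U oU k; apply: (@CkM _ _ _ _ (cst _) (flat 0 \o q)) => //.
    exact: Ck_cst.
  exact: Cinf_flat (Cq _ oU) k.
- by rewrite mulVf// gt_eqF.
- by apply: (@rV_compact _ _ (fun j => [set` I j])) => j; exact: segment_compact.
- move=> x Kx; apply: rV; rewrite -ball_normE/= /Num.Def.normr/= mx_normrE.
  apply: bigmax_lt => // -[i j] _; rewrite !mxE/= ord1.
  have := Kx j; rewrite /= in_itv/= => /andP[h1 h2].
  rewrite (@le_lt_trans _ _ (r / 2))//; last first.
    by rewrite ltr_pdivrMr// ltr_pMr// ltr1n.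
  by rewrite ler_norml; apply/andP; split; lra.
- move=> x nK; suff -> : flat 0 (q x) = 0 by rewrite mulr0.
  rewrite /flat; case: ifPn => // qx.
  exfalso; apply: nK => j; rewrite /= in_itv/=.
  have : `|x 0 j - a 0 j| <= r / 2.
    rewrite -(@ler_pXn2r _ 2) ?nnegrE// ?(ltW r2)// real_normK ?num_real//.
    apply: le_trans (ltW _); last by rewrite -subr_gt0; exact: qx.
    by rewrite (bigD1 j)//= lerDl sumr_ge0// => i _; exact: sqr_ge0.
  by rewrite ler_norml => /andP[h1 h2]; apply/andP; split; lra.
Qed.

(** * Smooth maps, tangent vectors and their extension to vector fields *)

Lemma open_chart_image (R : realType) m (M : topologicalType) (e : chart R m M)
    (A : set M) : open A -> open (cmap e @` (cdom e `&` A)).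
Proof.
move=> oA; rewrite openE => x [p [ep Ap] <-{x}].
have cp : (cmap e @` cdom e) (cmap e p) by exists p.
have Ai : \forall y \near cmap e p, A (cinv e y).
  by apply: (cinv_continuous cp); rewrite cmapK//; exact: open_near.
move: Ai (open_near (@ccod_open _ _ _ e) cp); apply: filterS2 => y Ay [q eq qy].
by exists q => //; split=> //; rewrite -(cmapK eq) qy.
Qed.

(** Seen as a smooth map, the identity makes every fact below on smooth maps
    a fact on changes of charts. *)
Lemma smooth_map_id (R : realType) m (M : manifold R m) :
  smooth_map (@id M).
Proof. by split=> [p|e e' ae ae' j]; [exact: cvg_id|exact: atlas_compatible]. Qed.

Section SmoothFunctions.
Context {R : realType} {m : nat} {M : manifold R m}.
Implicit Types (f h : M -> R).

Lemma smooth_cst (a : R) : smooth (fun _ : M => a).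
Proof. by move=> e _ k; exact: Ck_cst. Qed.

Lemma smoothD f h : smooth f -> smooth h -> smooth (fun p => f p + h p).
Proof.
move=> sf sh e ae k.
by apply: (CkD (@ccod_open _ _ _ e)); [exact: sf|exact: sh].
Qed.

Lemma smoothM f h : smooth f -> smooth h -> smooth (fun p => f p * h p).
Proof.
move=> sf sh e ae k.
by apply: (CkM (@ccod_open _ _ _ e)); [exact: sf|exact: sh].
Qed.

Lemma smoothN f : smooth f -> smooth (fun p => - f p).
Proof.
move=> sf; have -> : (fun p => - f p) = (fun p => -1 * f p).
  by apply/funext => p; rewrite mulN1r.
by apply: smoothM => //; exact: smooth_cst.
Qed.

Lemma smooth_differentiable f e p : smooth f -> atlas e -> cdom e p ->
  differentiable (f \o cinv e) (cmap e p).
Proof.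
by move=> sf ae ep; have [d _] := sf e ae 1%N; apply: d; exists p.
Qed.

End SmoothFunctions.

Section SmoothMaps.
Context {R : realType} {k m : nat} {S : manifold R k} {M : manifold R m}.
Variable iota : S -> M.
Hypothesis iota_smooth : smooth_map iota.

Let local_map (e : chart R k S) (e' : chart R m M) : 'rV[R]_k -> 'rV[R]_m :=
  fun x => cmap e' (iota (cinv e x)).

Lemma Cinf_pullback e e' h : atlas e -> atlas e' ->
  Cinf (cmap e' @` cdom e') h ->
  Cinf (cmap e @` (cdom e `&` iota @^-1` cdom e')) (h \o local_map e e').
Proof.
move=> ae ae' Ch; have [ci si] := iota_smooth.
apply: Ck_comp Ch => [|x [p [ep e'p] <-]|j].
- apply: open_chart_image.
  by apply: open_comp (@cdom_open _ _ _ e') => q _; exact: ci.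
- by rewrite /local_map cmapK//; exists (iota p).
- exact: si.
Qed.

Lemma smooth_comp (f : M -> R) : smooth f -> smooth (f \o iota).
Proof.
move=> sf e ae n; have [ci si] := iota_smooth.
apply: Ck_local => _ [p ep <-].
have [e' ae' e'p] := atlas_cover (iota p).
have oV : open (cmap e @` (cdom e `&` iota @^-1` cdom e')).
  apply: open_chart_image.
  by apply: open_comp (@cdom_open _ _ _ e') => q _; exact: ci.
exists (cmap e @` (cdom e `&` iota @^-1` cdom e')); split=> //; first by exists p.
apply: (Ck_eq oV) (Cinf_pullback ae ae' (sf e' ae') n) => x [q [eq e'q] <-].
by rewrite /local_map/= !cmapK.
Qed.

Lemma differential_chart_vec e e' a p : atlas e -> atlas e' ->
  cdom e p -> cdom e' (iota p) ->
  exists b, differential iota (chart_vec e a p) = chart_vec e' b (iota p).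
Proof.
move=> ae ae' ep e'p; have [ci si] := iota_smooth.
exists (\row_j 'D_a (fun x => local_map e e' x 0 j) (cmap e p)).
apply/funext => f; rewrite /differential /chart_vec.
case: ifPn => // /asboolP sf; rewrite ifT; last first.
  by apply/asboolP; exact: smooth_comp.
have Vp : (cmap e @` (cdom e `&` iota @^-1` cdom e')) (cmap e p) by exists p.
have oV : open (cmap e @` (cdom e `&` iota @^-1` cdom e')).
  apply: open_chart_image.
  by apply: open_comp (@cdom_open _ _ _ e') => q _; exact: ci.
have -> : 'D_a ((f \o iota) \o cinv e) (cmap e p) =
          'D_a ((f \o cinv e') \o local_map e e') (cmap e p).
  apply: near_eq_derive; apply: filterS (open_near oV Vp) => x [q [eq e'q] <-].
  by rewrite /local_map/= !cmapK.
have lp : local_map e e' (cmap e p) = cmap e' (iota p).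
  by rewrite /local_map cmapK.
have df : differentiable (f \o cinv e') (cmap e' (iota p)).
  exact: smooth_differentiable.
rewrite derive_chain; last by rewrite lp.
  rewrite lp (deriveE _ df) [in RHS](row_sum_delta (\row__ _)) linear_sum/=.
  by apply: eq_bigr => j _; rewrite linearZ/= mxE (deriveE _ df).
apply: differentiable_row => j.
by have [d _] := si e e' ae ae' j 1%N; exact: (d _ Vp).
Qed.

Lemma tangent_differential p u : tangent p u ->
  tangent (iota p) (differential iota u).
Proof.
move=> [e [a [ae ep ->]]]; have [e' ae' e'p] := atlas_cover (iota p).
by have [b ->] := differential_chart_vec a ae ae' ep e'p; exists e', b.
Qed.

End SmoothMaps.

Section Tangent.
Context {R : realType} {m : nat} {M : manifold R m}.
Implicit Types (p : M) (u v : vec R M) (f h : M -> R).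

Lemma differential_id p u : tangent p u -> differential (@id M) u = u.
Proof.
move=> [e [a [_ _ ->]]]; apply/funext => f; rewrite /differential /chart_vec.
by case: ifPn => // /asboolP sf; rewrite !ifT//; exact/asboolP.
Qed.

Lemma chart_vec_linear (e : chart R m M) p c a b : atlas e -> cdom e p ->
  chart_vec e (c *: a + b) p = c *: chart_vec e a p + chart_vec e b p.
Proof.
move=> ae ep; apply/funext => f; rewrite !fctE /chart_vec.
case: ifPn => [/asboolP sf|_]; last by rewrite scaler0 addr0.
have df := smooth_differentiable sf ae ep.
by rewrite !(deriveE _ df) linearP.
Qed.

Lemma tangent_in_chart (e : chart R m M) p u : atlas e -> cdom e p ->
  tangent p u -> exists a, u = chart_vec e a p.
Proof.
move=> ae ep tu; rewrite -(differential_id tu).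
case: tu => [e' [a [ae' e'p ->]]].
exact: (differential_chart_vec (smooth_map_id M)).
Qed.

Lemma tangent_linear p c u v : tangent p u -> tangent p v ->
  tangent p (c *: u + v).
Proof.
move=> [e [a [ae ep ->]]] /(tangent_in_chart ae ep)[b ->].
by exists e, (c *: a + b); rewrite chart_vec_linear.
Qed.

Lemma tangent0 p : tangent p 0.
Proof.
have [e ae ep] := atlas_cover p; exists e, 0; split=> //.
by apply/funext => f; rewrite /chart_vec derive0 if_same.
Qed.

Lemma tangentZ p c u : tangent p u -> tangent p (c *: u).
Proof.
by move=> tu; rewrite -[c *: u]addr0; exact: tangent_linear (tangent0 p).
Qed.

Lemma tangentD p u v : tangent p u -> tangent p v -> tangent p (u + v).
Proof. by move=> tu tv; rewrite -[u]scale1r; exact: tangent_linear. Qed.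

Lemma tangentN p u : tangent p u -> tangent p (- u).
Proof. by rewrite -scaleN1r; exact: tangentZ. Qed.

Lemma tangent_nonsmooth p u f : tangent p u -> ~ smooth f -> u f = 0.
Proof.
by move=> [e [a [_ _ ->]]] nf; rewrite /chart_vec ifF//; apply/asboolP.
Qed.

Lemma tangent_cst p u (c : R) : tangent p u -> u (fun=> c) = 0.
Proof.
move=> [e [a [_ _ ->]]]; rewrite /chart_vec; case: ifP => // _.
exact: (derive_cst c).
Qed.

Lemma tangent_addf p u f h : tangent p u -> smooth f -> smooth h ->
  u (fun q => f q + h q) = u f + u h.
Proof.
move=> [e [a [ae ep ->]]] sf sh; rewrite /chart_vec !ifT; try exact/asboolP.
  by rewrite -deriveD//; apply: diff_derivable; exact: smooth_differentiable.
by apply/asboolP; exact: smoothD.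
Qed.

Lemma tangent_mulf p u f h : tangent p u -> smooth f -> smooth h ->
  u (fun q => f q * h q) = u f * h p + f p * u h.
Proof.
move=> [e [a [ae ep ->]]] sf sh; rewrite /chart_vec !ifT; try exact/asboolP.
  rewrite (deriveM (f := f \o cinv e) (g := h \o cinv e)); last 2 first.
  - by apply: diff_derivable; exact: smooth_differentiable.
  - by apply: diff_derivable; exact: smooth_differentiable.
  by rewrite /GRing.scale/= cmapK// addrC [_ * h p]mulrC.
by apply/asboolP; exact: smoothM.
Qed.

(** Outside the domain of [e] the extension vanishes near every point, because
    the compact set [cinv e @` K] is closed in a Hausdorff space. *)
Lemma smooth_extension (e : chart R m M) (b : 'rV[R]_m -> R) K :
  atlas e -> Cinf (cmap e @` cdom e) b -> compact K -> K `<=` cmap e @` cdom e ->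
  (forall x, ~ K x -> b x = 0) ->
  smooth (fun p => if `[< cdom e p >] then b (cmap e p) else 0).
Proof.
move=> ae Cb cK KV b0 e' ae' k; apply: Ck_local => _ [p e'p <-].
have [ep|nep] := pselect (cdom e p).
  have oV : open (cmap e' @` (cdom e' `&` cdom e)).
    by apply: open_chart_image; exact: cdom_open.
  exists (cmap e' @` (cdom e' `&` cdom e)); split=> //; first by exists p.
  apply: (Ck_eq oV) (Cinf_pullback (smooth_map_id M) ae' ae Cb k).
  by move=> _ [q [e'q eq] <-]; rewrite /= cmapK// ifT//; exact/asboolP.
have cKM : closed (cinv e @` K).
  apply: compact_closed; first exact: manifold_hausdorff.
  apply: continuous_compact => //; apply: continuous_in_subspaceT => x.
  by rewrite inE => /KV; exact: cinv_continuous.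
have oV : open (cmap e' @` (cdom e' `&` ~` (cinv e @` K))).
  by apply: open_chart_image; exact: closed_openC.
exists (cmap e' @` (cdom e' `&` ~` (cinv e @` K))); split=> //.
  exists p => //; split=> // -[x /KV[q eq <-]]; rewrite cmapK// => pq.
  by apply: nep; rewrite -pq.
apply: (Ck_eq oV) (Ck_cst k _ 0) => _ [q [e'q nq] <-]; rewrite /= cmapK//.
case: ifPn => // /asboolP eq; rewrite b0// => Kq; apply: nq.
by exists (cmap e q) => //; rewrite cmapK.
Qed.

(** A constant field in a chart, multiplied by a bump function. *)
Lemma vector_extension p u : tangent p u ->
  exists2 X : vfield R M, is_vfield X & X p = u.
Proof.
move=> [e [a [ae ep ->]]].
have cp : (cmap e @` cdom e) (cmap e p) by exists p.
have [b [K [Cb b1 cK KV b0]]] := bump_function (@ccod_open _ _ _ e) cp.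
exists (fun q => if `[< cdom e q >]
                 then chart_vec e (b (cmap e q) *: a) q else 0).
  split=> [q|f sf].
    case: ifPn => [/asboolP eq|_]; last exact: tangent0.
    by exists e, (b (cmap e q) *: a).
  set F := (X in smooth X).
  suff -> : F = fun q => if `[< cdom e q >] then
      (b \* (fun x => 'D_a (f \o cinv e) x)) (cmap e q) else 0.
    apply: (smooth_extension (K := K)) => // [k|x nK].
      apply: CkM; first exact: ccod_open.
        by apply: Cb; exact: ccod_open.
      by have [_ H] := sf e ae k.+1; exact: H.
    by rewrite /= b0// mul0r.
  apply/funext => q; rewrite /F; case: ifPn => // /asboolP eq.
  rewrite /chart_vec ifT; last exact/asboolP.
  have df := smooth_differentiable sf ae eq.
  by rewrite (deriveE _ df) linearZ/= (deriveE _ df).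
by rewrite ifT ?b1 ?scale1r//; exact/asboolP.
Qed.

End Tangent.

(** * The module of vector fields over the ring of smooth functions *)

(** Bundling smooth functions and vector fields gives a ring and a module, over
    which the algebra above applies. *)
Record smooth_function (R : realType) m (M : manifold R m) := SmoothFunction {
  smooth_fun :> M -> R;
  smooth_funP : smooth smooth_fun
}.
Record vector_field (R : realType) m (M : manifold R m) := VectorField {
  vf_fun :> vfield R M;
  vf_funP : is_vfield vf_fun
}.
HB.instance Definition _ R m (M : manifold R m) :=
  gen_eqMixin (smooth_function M).
HB.instance Definition _ R m (M : manifold R m) :=
  gen_choiceMixin (smooth_function M).
HB.instance Definition _ R m (M : manifold R m) :=
  gen_eqMixin (vector_field M).
HB.instance Definition _ R m (M : manifold R m) :=
  gen_choiceMixin (vector_field M).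

Section Bundles.
Context {R : realType} {m : nat} {M : manifold R m}.
Local Notation A := (smooth_function M).
Local Notation V := (vector_field M).
Implicit Types (f h : A) (X Y Z : V).

Lemma smooth_function_ext f h : (forall p, f p = h p) -> f = h.
Proof.
case: f h => [f sf] [h sh] /= /funext fh; case: _ / fh sh => sh.
by rewrite (Prop_irrelevance sf sh).
Qed.

Lemma vector_field_ext X Y : (forall p, X p = Y p) -> X = Y.
Proof.
case: X Y => [f sf] [h sh] /= /funext fh; case: _ / fh sh => sh.
by rewrite (Prop_irrelevance sf sh).
Qed.

Lemma vector_field_tangent X p : tangent p (X p).
Proof. by have [+ _] := vf_funP X; apply. Qed.

Definition sf_zero : A := SmoothFunction (smooth_cst 0).
Definition sf_one : A := SmoothFunction (smooth_cst 1).
Definition sf_opp f : A := SmoothFunction (smoothN (smooth_funP f)).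
Definition sf_add f h : A :=
  SmoothFunction (smoothD (smooth_funP f) (smooth_funP h)).
Definition sf_mul f h : A :=
  SmoothFunction (smoothM (smooth_funP f) (smooth_funP h)).

Fact sf_addA : associative sf_add.
Proof. by move=> f h l; apply: smooth_function_ext => p /=; rewrite addrA. Qed.
Fact sf_addC : commutative sf_add.
Proof. by move=> f h; apply: smooth_function_ext => p /=; rewrite addrC. Qed.
Fact sf_add0 : left_id sf_zero sf_add.
Proof. by move=> f; apply: smooth_function_ext => p /=; rewrite add0r. Qed.
Fact sf_addN : left_inverse sf_zero sf_opp sf_add.
Proof. by move=> f; apply: smooth_function_ext => p /=; rewrite addNr. Qed.
HB.instance Definition _ :=
  GRing.isZmodule.Build A sf_addA sf_addC sf_add0 sf_addN.

Fact sf_mulA : associative sf_mul.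
Proof. by move=> f h l; apply: smooth_function_ext => p /=; rewrite mulrA. Qed.
Fact sf_mulC : commutative sf_mul.
Proof. by move=> f h; apply: smooth_function_ext => p /=; rewrite mulrC. Qed.
Fact sf_mul1 : left_id sf_one sf_mul.
Proof. by move=> f; apply: smooth_function_ext => p /=; rewrite mul1r. Qed.
Fact sf_mulD : left_distributive sf_mul sf_add.
Proof. by move=> f h l; apply: smooth_function_ext => p /=; rewrite mulrDl. Qed.
HB.instance Definition _ :=
  GRing.Zmodule_isComPzRing.Build A sf_mulA sf_mulC sf_mul1 sf_mulD.

Fact vf_zero_vfield : is_vfield (fun _ : M => 0).
Proof. by split=> [p|f sf]; [exact: tangent0|exact: smooth_cst]. Qed.
Definition vf_zero : V := VectorField vf_zero_vfield.

Fact vf_add_vfield X Y : is_vfield (fun p => X p + Y p).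
Proof.
split=> [p|f sf]; first by apply: tangentD; exact: vector_field_tangent.
by apply: smoothD; [case: (vf_funP X)|case: (vf_funP Y)] => _; apply.
Qed.
Definition vf_add X Y : V := VectorField (vf_add_vfield X Y).

Fact vf_scale_vfield f X : is_vfield (fun p => f p *: X p).
Proof.
split=> [p|h sh]; first by apply: tangentZ; exact: vector_field_tangent.
by apply: smoothM; [exact: smooth_funP|case: (vf_funP X) => _; apply].
Qed.
Definition vf_scale f X : V := VectorField (vf_scale_vfield f X).
Definition vf_opp X : V := vf_scale (- 1) X.

Fact vf_addA : associative vf_add.
Proof. by move=> X Y Z; apply: vector_field_ext => p /=; rewrite addrA. Qed.
Fact vf_addC : commutative vf_add.
Proof. by move=> X Y; apply: vector_field_ext => p /=; rewrite addrC. Qed.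
Fact vf_add0 : left_id vf_zero vf_add.
Proof. by move=> X; apply: vector_field_ext => p /=; rewrite add0r. Qed.
Fact vf_addN : left_inverse vf_zero vf_opp vf_add.
Proof.
by move=> X; apply: vector_field_ext => p /=; rewrite scaleN1r addNr.
Qed.
HB.instance Definition _ :=
  GRing.isZmodule.Build V vf_addA vf_addC vf_add0 vf_addN.

Fact vf_scaleA f h X : vf_scale f (vf_scale h X) = vf_scale (f * h) X.
Proof. by apply: vector_field_ext => p /=; rewrite scalerA. Qed.
Fact vf_scale1 : left_id 1 vf_scale.
Proof. by move=> X; apply: vector_field_ext => p /=; rewrite scale1r. Qed.
Fact vf_scaleDr : right_distributive vf_scale +%R.
Proof. by move=> f X Y; apply: vector_field_ext => p /=; rewrite scalerDr. Qed.
Fact vf_scaleDl X : {morph vf_scale^~ X : f h / f + h}.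
Proof. by move=> f h; apply: vector_field_ext => p /=; rewrite scalerDl. Qed.
HB.instance Definition _ := GRing.Zmodule_isLmodule.Build A V
  vf_scaleA vf_scale1 vf_scaleDr vf_scaleDl.

Fact vf_deriv_smooth X f : smooth (fun p => X p f).
Proof. by case: (vf_funP X) => _; apply; exact: smooth_funP. Qed.
Definition vf_deriv X f : A := SmoothFunction (vf_deriv_smooth X f).

Definition sf_const (c : R) : A := SmoothFunction (smooth_cst c).

Lemma sf_mulrn f n p : (f *+ n) p = f p *+ n.
Proof. by elim: n => [|n IH]; rewrite ?mulr0n// !mulrS -IH. Qed.

Section LeviCivita.
Variables (g : M -> vec R M -> vec R M -> R).
Variable (nabla : vfield R M -> vfield R M -> vfield R M).
Hypotheses (hg : riemannian_metric g) (hn : levi_civita g nabla).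

Definition metric_fun X Y : A :=
  SmoothFunction (metric_smooth hg (vf_funP X) (vf_funP Y)).
Definition nabla_field X Y : V :=
  VectorField (lc_vfield hn (vf_funP X) (vf_funP Y)).

Lemma bracket_commutator X Y : bracket X Y = commutator nabla_field X Y.
Proof.
apply/funext => p.
by rewrite -(lc_torsion_free hn (vf_funP X) (vf_funP Y)) /= scaleN1r.
Qed.

Lemma curvature_riemann X Y Z :
  curvature nabla X Y Z = riemann nabla_field X Y Z.
Proof.
by apply/funext => p; rewrite /curvature bracket_commutator /= !scaleN1r.
Qed.

Lemma levi_civita_smooth : levi_civita_algebra vf_deriv metric_fun nabla_field.
Proof.
have T := vector_field_tangent; have VP := @vf_funP R m M.
split.
- move=> X Y; apply: smooth_function_ext => p.
  exact: (Defs.metric_sym hg (T X p) (T Y p)).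
- move=> a X Y Z; apply: smooth_function_ext => p.
  exact: (metric_linear hg (smooth_fun a p) (T X p) (T Y p) (T Z p)).
- move=> X X0; apply: vector_field_ext => p; apply: contrapT => /eqP Xp.
  have := metric_pos hg (T X p) Xp.
  by have /= -> := congr1 (fun f : A => f p) X0; rewrite ltxx.
- move=> X f h; apply: smooth_function_ext => p.
  exact: tangent_addf (T X p) (smooth_funP f) (smooth_funP h).
- move=> X f h; apply: smooth_function_ext => p.
  exact: tangent_mulf (T X p) (smooth_funP f) (smooth_funP h).
- by move=> a X Y b; apply: smooth_function_ext.
- move=> X X0; apply: vector_field_ext => p; apply/funext => f.
  have [sf|nf] := pselect (smooth f); last exact: tangent_nonsmooth (T X p) nf.
  by have := congr1 (fun h : A => h p) (X0 (SmoothFunction sf)).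
- move=> a X Y Z; apply: vector_field_ext => p.
  exact: (lc_linear hn (smooth_funP a) (VP X) (VP Y) (VP Z)).
- move=> a X Y Z; apply: vector_field_ext => p.
  exact: (lc_leibniz hn (smooth_funP a) (VP X) (VP Y) (VP Z)).
- move=> X Y f; apply: smooth_function_ext => p.
  rewrite -[LHS]/(vf_fun (commutator nabla_field X Y) p f).
  by rewrite -bracket_commutator.
- move=> X Y Z; apply: smooth_function_ext => p.
  exact: (lc_metric hn (VP X) (VP Y) (VP Z)).
- move=> n f f0; apply: smooth_function_ext => p.
  have := congr1 (fun h : A => h p) f0; rewrite sf_mulrn /= => /eqP.
  by rewrite mulrn_eq0 => /eqP.
Qed.

End LeviCivita.
End Bundles.

(** * Kenmotsu manifolds of constant phi-sectional curvature *)

Section KenmotsuFields.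
Context {R : realType} {m : nat} {M : manifold R m}.
Variables (phi : M -> vec R M -> vec R M) (xi : vfield R M).
Variables (eta : M -> vec R M -> R) (g : M -> vec R M -> vec R M -> R).
Variable (nabla : vfield R M -> vfield R M -> vfield R M).
Hypothesis hK : kenmotsu phi xi eta g nabla.

Let hA := kenmotsu_acm hK.
Let hg := acm_metric hA.
Let hn := kenmotsu_lc hK.
Local Notation V := (vector_field M).
Local Notation gf := (metric_fun hg).
Local Notation N := (nabla_field hn).
Let T := @vector_field_tangent R m M.

Definition phi_field (X : V) : V := VectorField (phi_smooth hA (vf_funP X)).
Definition xi_field : V := VectorField (xi_vfield hA).

Lemma xi_tangent p : tangent p (xi p).
Proof. exact: (T xi_field p). Qed.

Lemma metric_0l p v : tangent p v -> g p 0 v = 0.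
Proof.
move=> tv; have := metric_linear hg 1 (tangent0 p) (tangent0 p) tv.
by rewrite scaler0 addr0 mul1r => /esym/(canRL (addrK _)); rewrite subrr.
Qed.

Lemma metric_0r p v : tangent p v -> g p v 0 = 0.
Proof.
by move=> tv; rewrite (Defs.metric_sym hg tv (tangent0 p)) metric_0l.
Qed.

Lemma metric_Zl p a u v : tangent p u -> tangent p v ->
  g p (a *: u) v = a * g p u v.
Proof.
move=> tu tv; have := metric_linear hg a tu (tangent0 p) tv.
by rewrite metric_0l// !addr0.
Qed.

Lemma metric_Zr p a u v : tangent p u -> tangent p v ->
  g p v (a *: u) = a * g p v u.
Proof.
move=> tu tv; rewrite (Defs.metric_sym hg tv (tangentZ a tu)) metric_Zl//.
by rewrite (Defs.metric_sym hg tu tv).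
Qed.

Lemma metric_xi p u : tangent p u -> g p u (xi p) = eta p u.
Proof.
move=> tu; have := g_phi hA tu (xi_tangent p).
rewrite (phi_xi hA) (eta_xi hA) mulr1 metric_0r; last exact: (phi_tangent hA).
by move/esym/subr0_eq.
Qed.

Lemma kenmotsu_fields : kenmotsu_algebra gf N phi_field xi_field.
Proof.
split.
- move=> a X Y; apply: vector_field_ext => p.
  exact: (phi_linear hA (smooth_fun a p) (T X p) (T Y p)).
- apply: smooth_function_ext => p /=.
  by rewrite metric_xi ?(eta_xi hA)//; exact: xi_tangent.
- by apply: vector_field_ext => p; exact: (phi_xi hA p).
- move=> X; apply: vector_field_ext => p /=.
  by rewrite /apply_phi scaleN1r metric_xi// (phi_phi hA (T X p)).
- move=> X Y; apply: smooth_function_ext => p /=.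
  by rewrite /apply_phi !metric_xi// (g_phi hA (T X p) (T Y p)).
- move=> X Y; apply: vector_field_ext => p /=.
  rewrite !scaleN1r metric_xi// -scaleNr.
  have := kenmotsu_phi hK (vf_funP X) (vf_funP Y) p.
  by rewrite scaleNr.
Qed.

Lemma nabla_xi_xi p : nabla xi xi p = 0.
Proof.
have := nabla_xi (levi_civita_smooth hg hn) kenmotsu_fields xi_field.
rewrite (ka_xi_unit kenmotsu_fields) scale1r subrr.
by move/(congr1 (fun X : V => X p)).
Qed.

Variable c : R.
Hypothesis hc : constant_phi_sectional_curvature phi xi g nabla c.

(** The hypothesis only concerns fields of unit length at the point considered,
    so a field is first multiplied by the constant [1 / |X p|]; where [X p = 0]
    both sides vanish. *)
Lemma phi_curvature_horizontal (X : V) : gf X xi_field = 0 ->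
  phi_curvature gf N phi_field X = sf_const c * gf X X ^+ 2.
Proof.
move=> X0; apply: smooth_function_ext => p.
have L := levi_civita_smooth hg hn.
have [Xp|Xp] := eqVneq (X p) 0.
  have -> : phi_curvature gf N phi_field X p = 0.
    rewrite /phi_curvature; move: (riemann _ _ _ _) => Z.
    by rewrite /= Xp metric_0r.
  by rewrite /= Xp metric_0l ?mul0r ?mulr0//; exact: tangent0.
have s0 := metric_pos hg (T X p) Xp.
set s := g p (X p) (X p) in s0.
pose a : smooth_function M := sf_const (Num.sqrt s)^-1.
have a2 : (Num.sqrt s)^-1 ^+ 2 = s^-1 by rewrite exprVn sqr_sqrtr// ltW.
have Da (Y : V) : vf_deriv Y a = 0.
  by apply: smooth_function_ext => q; exact: tangent_cst (T Y q).
have gaa : gf (a *: X) (a *: X) = a ^+ 2 * gf X X.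
  apply: smooth_function_ext => q /=.
  by rewrite metric_Zl ?metric_Zr ?mulrA//; do ?apply: tangentZ; exact: T.
have ga0 : gf (a *: X) xi_field = 0.
  apply: smooth_function_ext => q.
  have /= X0q := congr1 (fun f => smooth_fun f q) X0.
  by rewrite /= metric_Zl ?X0q ?mulr0//; exact: xi_tangent.
have := hc (vf_funP (a *: X)) (p := p).
have /= -> := congr1 (fun f => smooth_fun f p) gaa.
have /= -> := congr1 (fun f => smooth_fun f p) ga0.
rewrite -/s -expr2 a2 mulVf ?gt_eqF// => /(_ erefl erefl).
rewrite (curvature_riemann hn (a *: X) (phi_field (a *: X)) (phi_field (a *: X))).
rewrite -[LHS]/(smooth_fun (phi_curvature gf N phi_field (a *: X)) p).
rewrite (phi_curvatureZ L kenmotsu_fields X Da).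
set F := phi_curvature gf N phi_field X; rewrite /= => <-; rewrite -/s.
set r := (Num.sqrt s)^-1 in a2 *.
have -> : r * (r * (r * r)) = s^-1 * s^-1 by rewrite -a2; ring.
by move: (smooth_fun F p) => Fp; field; rewrite gt_eqF.
Qed.

(** The horizontal part [Y] of a field extending [u] satisfies
    [(1 + c) |Y|^4 = 0]. *)
Lemma tangent_spanned_by_xi p u : c <> -1 -> tangent p u ->
  u = eta p u *: xi p.
Proof.
move=> c1 tu; have [X vX Xp] := vector_extension tu.
have L := levi_civita_smooth hg hn.
have cD (Z : V) : vf_deriv Z (sf_const c) = 0.
  by apply: smooth_function_ext => q; exact: tangent_cst (T Z q).
pose Y : V := VectorField vX - gf (VectorField vX) xi_field *: xi_field.
have Y0 : gf Y xi_field = 0 by exact: (eta_horizontal_part L kenmotsu_fields).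
have := congr1 (fun f => smooth_fun f p)
  (constant_phi_curvature L kenmotsu_fields cD phi_curvature_horizontal Y0).
have YE : Y p = u - eta p u *: xi p.
  by rewrite /Y/= scaleN1r Xp metric_xi.
have tY := T Y p; rewrite -[LHS]/((1 + c) * (g p (Y p) (Y p) * g p (Y p) (Y p))).
move/eqP; rewrite !mulf_eq0 orbb addrC addr_eq0 => /orP[/eqP //|/eqP gY].
apply/eqP; rewrite -subr_eq0 -YE; apply/eqP; apply: contrapT => /eqP Yp.
by have := metric_pos hg tY Yp; rewrite gY ltxx.
Qed.

End KenmotsuFields.

(** * Totally umbilical submanifolds tangent to xi *)

Section TotallyUmbilical.
Context {R : realType} {k m : nat} {S : manifold R k} {M : manifold R m}.
Variables (phi : M -> vec R M -> vec R M) (xi : vfield R M).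
Variables (eta : M -> vec R M -> R) (g : M -> vec R M -> vec R M -> R).
Variable (nabla : vfield R M -> vfield R M -> vfield R M).
Hypothesis hK : kenmotsu phi xi eta g nabla.
Variable iota : S -> M.
Hypothesis iota_smooth : smooth_map iota.

Let hA := kenmotsu_acm hK.
Let hg := acm_metric hA.

Lemma normal0 p : normal iota g p 0.
Proof.
split; first exact: tangent0.
by move=> u tu; apply: (metric_0l hK); exact: tangent_differential.
Qed.

Lemma differential0 : differential iota 0 = 0.
Proof. by apply/funext => f; rewrite /differential if_same. Qed.

Lemma normal_part0 p : normal_part iota g p 0 = 0.
Proof.
have [tu nu] : tangent p (tangential_part iota g p 0) /\
    normal iota g p (0 - differential iota (tangential_part iota g p 0)).
  rewrite /tangential_part; case: xgetP => [_ -> //|H].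
  case: (H 0); split; first exact: tangent0.
  by rewrite differential0 subrr; exact: normal0.
rewrite /normal_part.
move: (tangential_part iota g p 0) tu nu => u tu [tw /(_ u tu) gw].
have td := tangent_differential iota_smooth tu.
apply: contrapT => /eqP w0; have := metric_pos hg tw w0.
move: gw; rewrite sub0r -scaleN1r => gw.
by rewrite (metric_Zr hK) ?gw ?mulr0 ?ltxx//; exact: tangentZ.
Qed.

Lemma totally_umbilical_geodesic : tangent_to iota xi ->
  totally_umbilical iota g nabla -> totally_geodesic iota g nabla.
Proof.
move=> txi hU p X Y tX tY; rewrite (hU p X Y tX tY).
have nxi : tangent_near iota p xi.
  by split; [exact: xi_vfield hA|exact: nearW].
have := hU p xi xi nxi nxi.
rewrite /second_fundamental_form (nabla_xi_xi hK) normal_part0.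
rewrite (metric_xi hK) ?(eta_xi hA) ?scale1r; last exact: (xi_tangent hK).
by move=> <-; rewrite scaler0.
Qed.

Lemma phi_eq0_totally_real :
  (forall p u, tangent p u -> u = eta p u *: xi p) -> totally_real iota g phi.
Proof.
move=> H p u tu; set w := differential iota u.
have tw : tangent (iota p) w by exact: tangent_differential.
have tx := xi_tangent hK (iota p).
(* [phi_linear] with both vectors equal to [xi] avoids the value of [phi] at 0. *)
have := phi_linear hA (eta (iota p) w - 1) tx tx.
rewrite (phi_xi hA) scaler0 addr0 scalerBl scale1r subrK -(H _ _ tw) => ->.
exact: normal0.
Qed.

End TotallyUmbilical.

Theorem theorem8 (R : realType) (n k : nat)
  (M : manifold R (2 * n + 1)%N)
  (phi : M -> vec R M -> vec R M) (xi : vfield R M)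
  (eta : M -> vec R M -> R) (g : M -> vec R M -> vec R M -> R)
  (nabla : vfield R M -> vfield R M -> vfield R M) (c : R)
  (S : manifold R k) (iota : S -> M)
  (hM : kenmotsu_space_form phi xi eta g nabla c)
  (hS : immersion iota)
  (hxi : tangent_to iota xi)
  (hPA : partially_anti_invariant iota g phi xi)
  (hU : totally_umbilical iota g nabla) :
  (totally_geodesic iota g nabla /\ totally_real iota g phi) \/ c = - 1.
Proof.
have [hK hc] := hM; have [iota_smooth _] := hS.
have [->|/eqP c1] := eqVneq c (-1); [by right|left; split].
  exact: (totally_umbilical_geodesic hK).
apply: (phi_eq0_totally_real hK iota_smooth) => p u tu.
exact: (tangent_spanned_by_xi hK hc).
Qed.
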